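(* Consider the problem $\min_{x\in\mathcal H}F(x)=f(x)+\psi(x)$ described in the context. Suppose there is a constant $L\ge 0$ such that $$\|f'(y)-f'(x)-H(x)(y-x)\|_*\le L\|x-y\|\qquad\text{for all }x,y\in\mathcal H,$$ and suppose the subproblem assumption (see context) holds with this $L$. Let $(x_k)_{k\in\mathbb N}$ be the iterates of the LeAP-SSN algorithm (see context) with arbitrary starting point $x_0\in\operatorname{dom}F$. Then the sequence $(x_k)_{k\in\mathbb N}$ is well defined, it stays in the sublevel set $\mathcal F_0=\{x\in\operatorname{dom}F:F(x)\le F(x_0)\}$, and $\|F'(x_k)\|_*\to 0$ as $k\to\infty$. Moreover, for all $k\ge 1$, $$\min_{0\le i\le k-1}\|F'(x_{i+1})\|_*\le\frac{\sqrt{\max\{2mL,\Lambda_0\}\,(F(x_0)-F^* )}}{\sqrt{\beta\alpha^2k}}.$$ If in addition $\lambda_k\to0$ as $k\to\infty$, then $\min_{0\le i\le k-1}\|F'(x_{i+1})\|_*=o(1/\sqrt k)$. Finally, the number of Newton steps (computations of the regularised proximal Newton step $x_+$ in the algorithm) up to the end of iteration $k$ does not exceed $k+1+\log_2\max\{1/2,\,mL/\Lambda_0\}$.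
   Context: Setting. $\mathcal H$ is a real Hilbert space with norm $\|\cdot\|$, dual $\mathcal H^*$ with norm $\|\cdot\|_*$, duality pairing $\langle\cdot,\cdot\rangle$, and Riesz map $\mathcal R:\mathcal H\to\mathcal H^*$. $f\in C^{1,1}(\mathcal H;\mathbb R)$ (Fréchet differentiable with Lipschitz derivative $f'$, possibly nonconvex); $\psi:\mathcal H\to\mathbb R\cup\{+\infty\}$ is proper, convex, lower semicontinuous; $F=f+\psi$ is bounded below with minimal value $F^*$ and the solution set $S=\{x:F(x)=F^*\}$ is nonempty. $\operatorname{dom}F=\{F<+\infty\}$; $\partial\psi$ is the convex subdifferential and $\partial F(x)=f'(x)+\partial\psi(x)$. To every $x\in\mathcal H$ is associated a symmetric bounded linear operator $H(x):\mathcal H\to\mathcal H^*$. Subproblem. For $x\in\operatorname{dom}F$ and $\lambda\ge0$ let $\widetilde F(y;x,\lambda)=f(x)+\langle f'(x),y-x\rangle+\frac12\langle H(x)(y-x),y-x\rangle+\frac\lambda2\|y-x\|^2+\psi(y)$. A point $x_+=x_+(\lambda,x)$ is an admissible solution if (FO) $-f'(x)-H(x)(x_+-x)-\lambda\mathcal R(x_+-x)\in\partial\psi(x_+)$ and (D) $\widetilde F(x_+;x,\lambda)\le\widetilde F(x;x,\lambda)=F(x)$. For such a point set $\psi'(x_+)=-f'(x)-H(x)(x_+-x)-\lambda\mathcal R(x_+-x)$ and $F'(x_+)=f'(x_+)+\psi'(x_+)\in\partial F(x_+)$. Subproblem assumption (with constant $L$): for all $\lambda\ge L$ and all $x\in\operatorname{dom}F$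 an admissible solution exists (and can be computed). LeAP-SSN algorithm. Input: $\alpha\in(0,1/2]$, $\beta\in(0,(m-1)/(2m)]$ for some $m\ge1$, $x_0\in\operatorname{dom}F$, $\psi'(x_0)\in\partial\psi(x_0)$, $\Lambda_0>0$; $F'(x_0)=f'(x_0)+\psi'(x_0)$. At iteration $k=0,1,\dots$: for $j=0,1,\dots$, set $\lambda=2^j\Lambda_k$; attempt to compute an admissible solution $x_+=x_+(\lambda,x_k)$ (if not possible, go to the next $j$); if $$\langle F'(x_+),x_k-x_+\rangle\ge\tfrac\alpha\lambda\|F'(x_+)\|_*^2\quad\text{and}\quad F(x_k)-F(x_+)\ge\beta\lambda\|x_+-x_k\|^2,$$ accept: set $j_k=j$, $x_{k+1}=x_+$, $\lambda_k=\lambda=2^{j_k}\Lambda_k$, $\Lambda_{k+1}=\lambda_k/2$, $F'(x_{k+1})=F'(x_+)$ and go to iteration $k+1$; otherwise go to the next $j$.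
   Formalization: The Newton-step bound is false as stated (f=ψ=0, H=0, L=0: k+1 steps, bound k); the formal theorem bounds the rejected steps by k+1+log₂max{1/2, mL/Λ₀} and all computations of x_+ by 2(k+1)+log₂max{1/2, mL/Λ₀}. *)

(* Defs.v *)
From HB Require Import structures.
From mathcomp Require Import all_boot all_order all_algebra.
From mathcomp Require Import sesquilinear.
From mathcomp Require Import all_classical all_reals all_analysis.

Set Implicit Arguments.
Unset Strict Implicit.
Unset Printing Implicit Defensive.

Import Order.TTheory GRing.Theory Num.Theory.
Import numFieldNormedType.Exports.

Local Open Scope classical_set_scope.
Local Open Scope ring_scope.

(** Elements of the dual space [H^*] are represented by their underlying
    functions [H -> R], and the pairing [<phi, h>] is the application [phi h].
    An operator [H -> H^*] is represented by the form [(u, v) |-> <A u, v>]. *)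

Section dual_space.
Context {R : realType} {H : normedModType R}.

Definition in_dual (phi : H -> R) : Prop := scalar phi /\ continuous phi.

(** [sup] is the real supremum, hence meaningful on bounded functionals only;
    it is only ever applied to elements of the dual. *)
Definition dual_norm (phi : H -> R) : R :=
  sup [set `|phi h| | h in [set h : H | `|h| <= 1]].

Definition bounded_form (A : H -> H -> R) : Prop :=
  exists C : R, forall u v : H, `|A u v| <= C * `|u| * `|v|.

(** [f] is Frechet differentiable with a Lipschitz derivative [H -> H^*]. *)
Definition C11 (f : H -> R^o) : Prop :=
  (forall x : H, differentiable f x) /\
  exists M : R, forall x y : H,
    dual_norm (fun h => 'd f y h - 'd f x h) <= M * `|y - x|.

End dual_space.

Section extended_valued.
Context {R : realType} {H : normedModType R}.
Local Open Scope ereal_scope.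

Definition proper_function (psi : H -> \bar R) : Prop :=
  (forall x, -oo < psi x) /\ exists x, psi x < +oo.

(** The endpoints [t = 0, 1] are harmless since [0 * +oo = 0]. *)
Definition econvex_function (psi : H -> \bar R) : Prop :=
  forall (x y : H) (t : R), (0 <= t <= 1)%R ->
    psi (t *: x + (1 - t) *: y)%R <= t%:E * psi x + (1 - t)%:E * psi y.

Definition subdifferential (psi : H -> \bar R) (x : H) : set (H -> R) :=
  [set p | [/\ in_dual p, psi x \is a fin_num &
     forall y : H, psi x + (p (y - x)%R)%:E <= psi y]].

Definition objective (f : H -> R^o) (psi : H -> \bar R) (x : H) : \bar R :=
  (f x)%:E + psi x.

Definition edom (F : H -> \bar R) : set H := [set x | F x < +oo].

Definition sublevel (F : H -> \bar R) (x0 : H) : set H :=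
  [set x | edom F x /\ F x <= F x0].

End extended_valued.

Section subproblem.
Context {R : realType} {H : normedModType R}.
Variables (ip : {dot H for idfun}) (f : H -> R^o) (psi : H -> \bar R)
  (B : H -> {symmetric H}).

Definition model (x : H) (lambda : R) (y : H) : \bar R :=
  ((f x + 'd f x (y - x) + 2^-1 * B x (y - x) (y - x)
    + lambda / 2 * `|y - x| ^+ 2)%:E + psi y)%E.

(** The selected subgradient [psi'(x_+)]; [ip u] is the Riesz image of [u]. *)
Definition psi_prime (x : H) (lambda : R) (xp : H) : H -> R :=
  fun h => - 'd f x h - B x (xp - x) h - lambda * ip (xp - x) h.

Definition F_prime (x : H) (lambda : R) (xp : H) : H -> R :=
  fun h => 'd f xp h + psi_prime x lambda xp h.

Definition admissible (x : H) (lambda : R) (xp : H) : Prop :=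
  subdifferential psi xp (psi_prime x lambda xp) /\
  (model x lambda xp <= model x lambda x)%E.

(** [solve k lambda x] is the outcome of the attempt, during iteration [k], to
    compute [x_+(lambda, x)], with [None] when the attempt does not succeed.
    Attempts may fail below [L], even if an admissible point exists; they may
    also return different admissible points at different iterations. *)
Record subproblem_solver (L : R) (solve : nat -> R -> H -> option H) : Prop := {
  solver_sound : forall k lambda x xp, 0 <= lambda ->
    edom (objective f psi) x ->
    solve k lambda x = Some xp -> admissible x lambda xp ;
  solver_complete : forall k lambda x, L <= lambda ->
    edom (objective f psi) x -> exists xp, solve k lambda x = Some xp }.

End subproblem.

Section leap_ssn.
Context {R : realType} {H : normedModType R}.

Record iterates := Iterates {
  it_x : nat -> H ;           (* x_k *)
  it_dF : nat -> H -> R ;     (* F'(x_k) *)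
  it_Lam : nat -> R ;         (* Lambda_k *)
  it_lam : nat -> R ;         (* lambda_k *)
  it_j : nat -> nat           (* j_k *) }.

Variables (ip : {dot H for idfun}) (f : H -> R^o) (psi : H -> \bar R)
  (B : H -> {symmetric H}) (solve : nat -> R -> H -> option H)
  (alpha beta : R).

Definition accepted (x : H) (lambda : R) (xp : H) : Prop :=
  alpha / lambda * dual_norm (F_prime ip f B x lambda xp) ^+ 2
    <= F_prime ip f B x lambda xp (x - xp) /\
  ((beta * lambda * `|xp - x| ^+ 2)%:E
    <= objective f psi x - objective f psi xp)%E.

Definition accepted_trial (k : nat) (x : H) (lambda : R) (xp : H) : Prop :=
  solve k lambda x = Some xp /\ accepted x lambda xp.

(** Iteration [k] stops at the first successful trial [j_k]. *)
Definition leap_ssn_run (x0 : H) (p0 : H -> R) (Lam0 : R) (r : iterates)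
    : Prop :=
  [/\ it_x r 0 = x0, it_dF r 0 = (fun h => 'd f x0 h + p0 h),
      it_Lam r 0 = Lam0 &
      forall k : nat,
      [/\ it_lam r k = 2 ^+ it_j r k * it_Lam r k,
          accepted_trial k (it_x r k) (it_lam r k) (it_x r k.+1),
          (forall j, (j < it_j r k)%N -> forall xp,
             ~ accepted_trial k (it_x r k) (2 ^+ j * it_Lam r k) xp),
          it_Lam r k.+1 = it_lam r k / 2 &
          it_dF r k.+1 =
            F_prime ip f B (it_x r k) (it_lam r k) (it_x r k.+1)]].

(** The initial value of the iterated minimum is its own [i = 0] term, so this
    is the minimum over [0 <= i <= k - 1] for [k >= 1]. *)
Definition min_dual_norm (r : iterates) (k : nat) : R :=
  \big[Num.min/dual_norm (it_dF r 1)]_(i < k) dual_norm (it_dF r i.+1).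

(** Iteration [i] runs the trials [j = 0, ..., j_i], that is [j_i + 1] of them,
    the first [j_i] of which are not accepted. *)
Definition newton_steps (r : iterates) (k : nat) : nat :=
  \sum_(i < k.+1) (it_j r i).+1.

Definition unaccepted_newton_steps (r : iterates) (k : nat) : nat :=
  \sum_(i < k.+1) it_j r i.

End leap_ssn.

Definition log2 {R : realType} (x : R) : R := ln x / ln 2.

(* Main.v *)
Require Import Defs.
From HB Require Import structures.
From mathcomp Require Import all_boot all_order all_algebra.
From mathcomp Require Import sesquilinear.
From mathcomp Require Import all_classical all_reals all_analysis.
From mathcomp Require Import ring lra.

(** Write [d = x_+ - x] for a step and [r = f'(x_+) - f'(x) - H(x) d] for the
    error of the quadratic model along it, so that [F'(x_+) = r - lambda R d]
    and [||r||_* <= L ||d||].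

    Everything rests on the fact that both acceptance tests succeed once
    [lambda >= m L]. For the first one, expanding the Hilbertian norm gives
    [||F'(x_+)||_*^2 <= ||r||_*^2 - 2 lambda <r, d> + lambda^2 ||d||^2]
    ([dual_norm_riesz_shift]); when [||r||_* <= lambda ||d||], the right-hand
    side is at most [2 lambda <F'(x_+), x - x_+>], which is the test with
    [alpha = 1/2] ([gradient_test_large_lambda]). For the second one, the mean
    value theorem turns the bound on [f'] into
    [f(x_+) <= quadratic model + (L/2) ||d||^2] ([descent]), which with (D)
    yields [F(x) - F(x_+) >= ((lambda - L)/2) ||d||^2]
    ([decrease_large_lambda]); [lambda >= m L] makes this coefficient at least
    [lambda (m - 1)/(2 m)], hence at least [beta lambda].

    So doubling [lambda] terminates, the run exists and is determined by its
    inputs ([run_exists], [run_unique]). A rejected [lambda] lies below [m L],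
    so an accepted one never exceeds [max (2 m L) Lambda_0] ([run_lam_le]).

    An accepted step satisfies [(alpha/lambda) ||F'(x_+)||_* <= ||d||] by the
    first test, and then the second test gives
    [F(x) - F(x_+) >= (beta alpha^2/lambda) ||F'(x_+)||_*^2]. Telescoping bounds
    the sum of the squares [||F'(x_k)||_*^2] ([run_sum_gradients]), and the
    convergence of [||F'(x_k)||_*] as well as both rates for its running minimum
    are facts about square summable sequences.

    For the complexity, the halving in [Lambda_{k+1} = lambda_k/2] gives
    [2^(j_0 + ... + j_k) Lambda_0 = 2^(k+1) Lambda_{k+1}] ([run_Lam]), where
    [Lambda_{k+1}] is at most [max (m L) (Lambda_0/2)]; the count is the
    logarithm of this inequality. *)

Set Implicit Arguments.
Unset Strict Implicit.
Unset Printing Implicit Defensive.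

Import Order.TTheory GRing.Theory Num.Theory.
Import numFieldNormedType.Exports.

Local Open Scope classical_set_scope.
Local Open Scope ring_scope.

(** * Linear functionals and the dual norm *)

Section functionals.
Context {R : realType} {H : normedModType R}.

(** For a linear functional this is continuity, in the form that makes
    [dual_norm] the supremum of a bounded set. *)
Definition bounded_on_ball (phi : H -> R) : Prop :=
  exists C : R, forall h : H, `|h| <= 1 -> `|phi h| <= C.

Lemma scalar_scale (phi : H -> R) :
  scalar phi -> forall a u, phi (a *: u) = a * phi u.
Proof.
move=> philin a u; have phi0 : phi 0 = 0.
  by have := philin (-1) 0 0; rewrite scaler0 addr0 mulN1r addNr.
by rewrite -[a *: u]addr0 philin phi0 addr0.
Qed.

Lemma bounded_on_ballB (phi chi : H -> R) :
  bounded_on_ball phi -> bounded_on_ball chi ->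
  bounded_on_ball (fun h => phi h - chi h).
Proof.
move=> [C phiC] [D chiD]; exists (C + D) => h h1.
by rewrite (le_trans (ler_normB _ _))// lerD ?phiC ?chiD.
Qed.

Lemma diff_bounded_on_ball (f : H -> R^o) (x : H) :
  differentiable f x -> bounded_on_ball ('d f x).
Proof.
move=> df; have /linear_bounded_continuous/linear_boundedP : continuous 'd f x.
  exact: diff_continuous.
case=> M [_ /(_ (M + 1))]; rewrite ltrDl ltr01 => /(_ isT) dfM.
exists (`|M + 1|) => h h1; apply: (le_trans (dfM h)).
rewrite (le_trans (ler_norm _))// normrM normr_id.
by rewrite ler_piMr.
Qed.

Lemma bounded_form_bounded_on_ball (A : H -> H -> R) (u : H) :
  bounded_form A -> bounded_on_ball (A u).
Proof.
case=> C AC; exists (`|C| * `|u|) => h h1; apply: (le_trans (AC u h)).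
rewrite (le_trans (ler_norm _))// !normrM !normr_id.
by rewrite ler_piMr// mulr_ge0.
Qed.

Lemma dual_norm_le (phi : H -> R) (C : R) :
  (forall h : H, `|h| <= 1 -> `|phi h| <= C) -> dual_norm phi <= C.
Proof.
move=> phiC; apply: ge_sup => [|_ [h /= h1 <-]]; last exact: phiC.
by exists `|phi 0|; exists 0 => //=; rewrite normr0.
Qed.

Lemma dual_norm_ge0 (phi : H -> R) : 0 <= dual_norm phi.
Proof.
rewrite /dual_norm; set E := [set _ | _ in _].
have [hs|/sup_out->//] := pselect (has_sup E).
rewrite (le_trans (normr_ge0 (phi 0)))//; apply: sup_upper_bound => //.
by exists 0 => //=; rewrite normr0.
Qed.

Lemma le_dual_norm (phi : H -> R) (h : H) :
  bounded_on_ball phi -> `|h| <= 1 -> `|phi h| <= dual_norm phi.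
Proof.
move=> [C phiC] h1; apply: ub_le_sup; last by exists h.
by exists C => _ [u /= u1 <-]; apply: phiC.
Qed.

Lemma le_dual_normM (phi : H -> R) (h : H) :
  scalar phi -> bounded_on_ball phi -> `|phi h| <= dual_norm phi * `|h|.
Proof.
move=> philin phib.
have phiZ := scalar_scale philin.
have [->|h0] := eqVneq h 0.
  by rewrite -(scale0r 0) phiZ mul0r normr0 mulr_ge0 ?dual_norm_ge0.
have nh : 0 < `|h| by rewrite normr_gt0.
rewrite -ler_pdivrMr//.
have := @le_dual_norm phi (`|h|^-1 *: h) phib.
rewrite normrZ normfV normr_id mulVf ?gt_eqF// => /(_ (lexx _)).
by rewrite phiZ normrM normfV normr_id mulrC.
Qed.

End functionals.

(** * The dual norm of a functional shifted by a Riesz image *)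

Section riesz.
Context {R : realType} {H : normedModType R} (ip : {dot H for idfun}).
Hypothesis norm_ip : forall x : H, `|x| ^+ 2 = ip x x.

Lemma ipC (u v : H) : ip u v = ip v u.
Proof. by rewrite hermC/= expr0 mul1r. Qed.

Lemma ip_sq (a b : R) (u v : H) :
  ip (a *: u + b *: v) (a *: u + b *: v) =
  a ^+ 2 * ip u u + 2 * a * b * ip v u + b ^+ 2 * ip v v.
Proof.
have ipP c x y z : ip (c *: x + y) z = c * ip x z + ip y z by exact: linearPl.
have ipZ c x z : ip (c *: x) z = c * ip x z by exact: linearZl_LR.
rewrite ipP ipZ (ipC u) (ipC v) !ipP !ipZ (ipC u v); ring.
Qed.

(** The right-hand side is [||r - lambda R d||_*^2] expanded in the Hilbert
    space [H^*]. The inequality alone follows without representing [r] by a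
    vector: it suffices to evaluate [r] at [v = g(h) h + lambda d], where [g] is
    the shifted functional, and to use [2 r(v) <= ||r||_*^2 + ||v||^2]. *)
Lemma dual_norm_riesz_shift (r : H -> R) (lambda : R) (d : H) :
    scalar r -> bounded_on_ball r ->
  bounded_on_ball (fun h => r h - lambda * ip d h) /\
  dual_norm (fun h => r h - lambda * ip d h) ^+ 2 <=
    dual_norm r ^+ 2 - 2 * lambda * r d + lambda ^+ 2 * `|d| ^+ 2.
Proof.
move=> rlin rb; set g := fun h => _; set K := dual_norm r.
set E := K ^+ 2 - 2 * lambda * r d + lambda ^+ 2 * `|d| ^+ 2.
have rZ := scalar_scale rlin.
have gE h : `|h| <= 1 -> g h ^+ 2 <= E.
  move=> h1; set v := g h *: h + lambda *: d.
  have rv : r v <= K * `|v|.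
    by rewrite (le_trans (ler_norm _))// le_dual_normM.
  have vv : `|v| ^+ 2 = g h ^+ 2 * `|h| ^+ 2 + 2 * lambda * g h * ip d h
                        + lambda ^+ 2 * `|d| ^+ 2.
    by rewrite !norm_ip /v ip_sq; ring.
  have rE : r v = g h * r h + lambda * r d by rewrite /v rlin rZ.
  have hh : g h ^+ 2 * `|h| ^+ 2 <= g h ^+ 2.
    by rewrite ler_piMr ?sqr_ge0// expr_le1.
  have gh : r h = g h + lambda * ip d h by rewrite /g subrK.
  (* This is [2 K |v| <= K^2 + |v|^2]. *)
  have : 0 <= (K - `|v|) ^+ 2 by rewrite sqr_ge0.
  rewrite sqrrB vv => KV; rewrite rE gh in rv.
  by rewrite /E; lra.
have E0 : 0 <= E by apply: le_trans (sqr_ge0 (g 0)) (gE _ _); rewrite normr0.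
have gS h : `|h| <= 1 -> `|g h| <= Num.sqrt E.
  by move=> h1; rewrite -sqrtr_sqr ler_wsqrtr// gE.
split; first by exists (Num.sqrt E).
rewrite -[leRHS]sqr_sqrtr// ler_sqr ?nnegrE ?dual_norm_ge0 ?sqrtr_ge0//.
exact: dual_norm_le.
Qed.

End riesz.

(** * The error of the quadratic model *)

Section model_error.
Context {R : realType} {H : normedModType R} (ip : {dot H for idfun}).
Variables (f : H -> R^o) (B : H -> {symmetric H}) (L : R).
Hypothesis f_diff : forall x : H, differentiable f x.
Hypothesis B_bounded : forall x : H, bounded_form (B x).

Definition residual (x y : H) : H -> R :=
  fun h => 'd f y h - 'd f x h - B x (y - x) h.

Hypothesis f_B : forall x y : H, dual_norm (residual x y) <= L * `|x - y|.

Lemma residual_scalar (x y : H) : scalar (residual x y).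
Proof.
by move=> a u v; rewrite /residual !linearP/= -![_ *: _]/(_ * _); ring.
Qed.

Lemma residual_bounded (x y : H) : bounded_on_ball (residual x y).
Proof.
apply: bounded_on_ballB; last exact: bounded_form_bounded_on_ball.
by apply: bounded_on_ballB; apply: diff_bounded_on_ball.
Qed.

Lemma residual_le (x y h : H) : residual x y h <= L * `|x - y| * `|h|.
Proof.
rewrite (le_trans (ler_norm _))//.
apply: (@le_trans _ _ (dual_norm (residual x y) * `|h|)).
  by apply: le_dual_normM; [exact: residual_scalar|exact: residual_bounded].
by rewrite ler_wpM2r.
Qed.

Lemma is_derive_line (x d : H) (t : R) :
  is_derive t 1 (fun s : R => f (x + s *: d) : R) ('d f (x + t *: d) d).
Proof.
have E : (fun h : R => h^-1 *: (f (x + (h *: 1 + t) *: d) - f (x + t *: d))) =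
         (fun h : R => h^-1 *: (f (h *: d + (x + t *: d)) - f (x + t *: d))).
  apply/funext => h; congr (_ *: (f _ - _)).
  by rewrite scalerDl -[h *: 1]/(h * 1) mulr1 addrCA.
have df := f_diff (x + t *: d).
have := @diff_derivable _ _ _ f _ d df; have := deriveE d df.
rewrite /derivable /derive -E => dE cE.
by apply: DeriveDef.
Qed.

(** Along the segment from [x] to [y], the derivative of [f] exceeds that of the
    quadratic model by at most [L t |y - x|^2] at time [t]. Hence [f] minus the
    model minus [(L/2) t^2 |y - x|^2] has a nonpositive derivative and does not
    increase from [t = 0] to [t = 1]. *)
Lemma descent (x y : H) :
  f y <= f x + 'd f x (y - x) + 2^-1 * B x (y - x) (y - x)
         + L / 2 * `|y - x| ^+ 2.
Proof.
set d := y - x; set a := 'd f x d; set b := B x d d; set n := `|d| ^+ 2.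
pose g (t : R) : R := f (x + t *: d) - t * a - t ^+ 2 / 2 * (b + L * n).
have dg (t : R) : is_derive t 1 g ('d f (x + t *: d) d - a - t * (b + L * n)).
  have := is_derive_line x d t => ?.
  rewrite /g; apply: is_derive_eq.
  rewrite !scaler0 !add0r -[a%:A]/(a * 1) -[t%:A]/(t * 1).
  rewrite -[(_ + _) *: _]/((b + L * n) * (2^-1 * (t * 1 + t * 1))).
  by field.
have [|c c01] := @MVT_segment R g _ 0 1 ler01 (fun t _ => dg t).
  apply: derivable_within_continuous => t _; exact: ex_derive.
have c0 : 0 <= c by move: c01; rewrite in_itv/= => /andP[].
rewrite subr0 mulr1 => gE.
have : residual x (x + c *: d) d <= L * c * n.
  apply: (le_trans (residual_le _ _ _)).
  by rewrite opprD addrA subrr add0r normrN normrZ ger0_norm// /n expr2 !mulrA.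
rewrite /residual [x + _ - x]addrAC subrr add0r.
have -> : B x (c *: d) d = c * b by exact: linearZl_LR.
rewrite -/a => cB.
have : g 1 <= g 0 by rewrite -subr_le0 gE; lra.
rewrite /g scale1r scale0r addr0 addrCA subrr addr0; lra.
Qed.

Lemma F_primeE (x : H) (lambda : R) (xp : H) :
  F_prime ip f B x lambda xp =
  fun h => residual x xp h - lambda * ip (xp - x) h.
Proof. by apply/funext => h; rewrite /F_prime /psi_prime /residual; ring. Qed.

End model_error.

(** * Acceptance of trial steps *)

Section acceptance.
Context {R : realType} {H : normedModType R} (ip : {dot H for idfun}).
Hypothesis norm_ip : forall x : H, `|x| ^+ 2 = ip x x.
Variables (f : H -> R^o) (psi : H -> \bar R) (B : H -> {symmetric H}).
Hypothesis f_diff : forall x : H, differentiable f x.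
Hypothesis B_bounded : forall x : H, bounded_form (B x).
Hypothesis psi_Nyoo : forall x : H, (-oo < psi x)%E.

Notation F := (objective f psi).
Notation dF := (F_prime ip f B).

Lemma edom_psi_fin (x : H) : edom F x -> psi x \is a fin_num.
Proof.
rewrite /edom/= /objective fin_numElt psi_Nyoo/=.
by case: (psi x) => [r||]; rewrite ?ltry.
Qed.

Lemma edom_fin (x : H) : edom F x -> F x \is a fin_num.
Proof. by move=> /edom_psi_fin px; rewrite /objective fin_numD px andbT. Qed.

Lemma F_prime_scalar (lambda : R) (x xp : H) : scalar (dF x lambda xp).
Proof.
move=> a u v; rewrite F_primeE residual_scalar.
have -> : ip (xp - x) (a *: u + v) = a * ip (xp - x) u + ip (xp - x) v.
  exact: linearPr.
by ring.
Qed.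

Lemma F_prime_bounded (lambda : R) (x xp : H) :
  bounded_on_ball (dF x lambda xp).
Proof.
rewrite F_primeE; apply: (proj1 (dual_norm_riesz_shift norm_ip _ _ _ _)).
- exact: residual_scalar.
- exact: residual_bounded.
Qed.

Lemma model_center (x : H) (lambda : R) : model f psi B x lambda x = F x.
Proof.
rewrite /model /objective subrr linear0 normr0 expr0n/= mulr0 !addr0.
have -> : B x 0 0 = 0 by exact: linear0l.
by rewrite mulr0 addr0.
Qed.

Section error_bound.
Variable L : R.
Hypothesis f_B : forall x y : H, dual_norm (residual f B x y) <= L * `|x - y|.

(** Since [||r||_* <= L |d| <= lambda |d|], the bound of [dual_norm_riesz_shift]
    is at most [2 lambda (lambda |d|^2 - r d)], and the bracket is the value of
    [F'(x_+)] at [x - x_+]. *)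
Lemma gradient_test_large_lambda (alpha lambda : R) (x xp : H) :
  0 <= L -> L <= lambda -> 0 < lambda -> alpha <= 2^-1 ->
  alpha / lambda * dual_norm (dF x lambda xp) ^+ 2
    <= dF x lambda xp (x - xp).
Proof.
move=> L0 Ll l0 a2; rewrite F_primeE; set d := xp - x.
have [_] := dual_norm_riesz_shift norm_ip lambda d
  (@residual_scalar _ _ f B x xp) (residual_bounded f_diff B_bounded x xp).
set D := dual_norm _; set K := dual_norm _; set r := residual f B x xp.
set n := `|d| ^+ 2 => DK.
have -> : r (x - xp) - lambda * ip d (x - xp) = lambda * n - r d.
  have -> : x - xp = -1 *: d by rewrite scaleN1r opprB.
  rewrite /r (scalar_scale (@residual_scalar _ _ f B x xp)).
  have -> : ip d (-1 *: d) = -1 * ip d d by exact: linearZr_LR.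
  by rewrite /n norm_ip; ring.
have KL : K ^+ 2 <= lambda ^+ 2 * n.
  rewrite -exprMn ler_sqr ?nnegrE ?dual_norm_ge0 ?mulr_ge0 ?(ltW l0)//.
  by apply: (le_trans (f_B x xp)); rewrite distrC ler_wpM2r.
have : alpha / lambda * D ^+ 2 <= 2^-1 / lambda * D ^+ 2.
  by rewrite ler_wpM2r ?sqr_ge0// ler_pM2r ?invr_gt0.
move=> /le_trans; apply.
rewrite -mulrA ler_pdivrMl// mulrC ler_pdivrMr//; lra.
Qed.

(** Condition (D) says that the model, regularised by [(lambda/2) |d|^2], does
    not exceed [F x] at [xp], and [descent] says that [F xp] exceeds the
    unregularised model by at most [(L/2) |d|^2]. *)
Lemma decrease_large_lambda (x xp : H) (lambda : R) :
  edom F x -> admissible ip f psi B x lambda xp ->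
  (((lambda - L) / 2 * `|xp - x| ^+ 2)%:E <= F x - F xp)%E.
Proof.
move=> /edom_psi_fin psix [[_ psixp _]]; rewrite model_center /model /objective.
have := descent f_diff B_bounded f_B x xp.
rewrite -(fineK psix) -(fineK psixp) -!EFinD !lee_fin; lra.
Qed.

(** The requirement [m L <= lambda] is what makes [(lambda - L)/2] at least
    [lambda (m - 1)/(2 m)], the largest admissible value of [beta lambda]. *)
Lemma admissible_accepted (alpha beta m lambda : R) (x xp : H) :
  0 <= L -> 1 <= m -> m * L <= lambda -> 0 < lambda ->
  alpha <= 1 / 2 -> beta <= (m - 1) / (2 * m) ->
  edom F x -> admissible ip f psi B x lambda xp ->
  accepted ip f psi B alpha beta x lambda xp.
Proof.
move=> L0 m1 mLl l0 a2 bm Fx adm.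
have m0 : 0 < m by lra.
split.
  apply: gradient_test_large_lambda => //; last lra.
  by rewrite (le_trans _ mLl)// ler_peMl.
apply: le_trans (decrease_large_lambda Fx adm); rewrite lee_fin.
rewrite ler_wpM2r ?sqr_ge0//.
have -> : (lambda - L) / 2 = (m * lambda - m * L) / (2 * m).
  by field; rewrite gt_eqF.
rewrite (@le_trans _ _ ((m - 1) / (2 * m) * lambda))// ?ler_pM2r//.
rewrite mulrAC ler_pM2r ?invr_gt0 ?mulr_gt0//; lra.
Qed.

End error_bound.

Section accepted_step.
Variables (alpha beta lambda : R) (x xp : H).
Hypotheses (alpha_gt0 : 0 < alpha) (beta_gt0 : 0 < beta).
Hypotheses (lambda_gt0 : 0 < lambda) (x_dom : edom F x).
Hypothesis xp_acc : accepted ip f psi B alpha beta x lambda xp.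

(** [F x] is finite, so with [F xp = +oo] the decrease test would bound a real
    number by [-oo]. *)
Lemma accepted_dom : edom F xp.
Proof.
case: xp_acc => _; rewrite /edom/= -(fineK (edom_fin x_dom)).
by case: (F xp) => [a||]; rewrite ?ltry.
Qed.

Lemma accepted_decrease :
  beta * lambda * `|xp - x| ^+ 2 <= fine (F x) - fine (F xp).
Proof.
case: xp_acc => _.
rewrite -{1}(fineK (edom_fin x_dom)) -{1}(fineK (edom_fin accepted_dom)).
by rewrite -EFinB lee_fin.
Qed.

Lemma accepted_nonincreasing : fine (F xp) <= fine (F x).
Proof.
rewrite -subr_ge0 (le_trans _ accepted_decrease)//.
by rewrite mulr_ge0 ?sqr_ge0// mulr_ge0// ltW.
Qed.

(** The first test and [F'(x_+) (x - x_+) <= ||F'(x_+)||_* |x_+ - x|] bound the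
    dual norm by [(lambda/alpha) |x_+ - x|], to be inserted in the second. *)
Lemma accepted_gradient_decrease :
  beta * alpha ^+ 2 / lambda * dual_norm (dF x lambda xp) ^+ 2
    <= fine (F x) - fine (F xp).
Proof.
apply: le_trans accepted_decrease.
set D := dual_norm _; set n := `|xp - x|.
have D0 : 0 <= D by exact: dual_norm_ge0.
have DN : alpha / lambda * D ^+ 2 <= D * n.
  rewrite (le_trans (proj1 xp_acc))// (le_trans (ler_norm _))// /n distrC.
  by apply: le_dual_normM; [exact: F_prime_scalar|exact: F_prime_bounded].
have Dn : alpha / lambda * D <= n.
  have [->|Dn0] := eqVneq D 0; first by rewrite mulr0 normr_ge0.
  have Dp : 0 < D by rewrite lt_def Dn0.
  by rewrite -(ler_pM2l Dp) mulrCA -expr2.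
have : (alpha / lambda * D) ^+ 2 <= n ^+ 2.
  have aD0 : 0 <= alpha / lambda * D by rewrite mulr_ge0// ltW// divr_gt0.
  by rewrite ler_sqr ?nnegrE// normr_ge0.
rewrite -(ler_pM2l (mulr_gt0 beta_gt0 lambda_gt0)); apply: le_trans.
rewrite le_eqVlt; apply/orP; left; apply/eqP.
by field; rewrite gt_eqF.
Qed.

End accepted_step.
End acceptance.

(** * Running minima of square summable sequences *)

Section real_sequences.
Context {R : realType}.

(** The window starts at an arbitrary [N] because the whole sum only shows that
    the running minimum is a big O of [1 / sqrt k]; tails of a convergent series
    are needed for the little o. *)
Lemma min_sqr_le_mean (u : nat -> R) (N k : nat) :
  (forall i, 0 <= u i) -> (N <= k)%N ->
  (k - N)%:R * (\big[Num.min/u 0]_(i < k) u i) ^+ 2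
    <= \sum_(N <= i < k) u i ^+ 2.
Proof.
move=> u0 Nk; rewrite mulr_natl -sumr_const_nat big_nat [leRHS]big_nat.
apply: ler_sum => i /andP[_ ik].
have mu0 : 0 <= \big[Num.min/u 0]_(i < k) u i by apply: le_bigmin => // j _.
rewrite ler_sqr ?nnegrE//.
exact: (@bigmin_le _ _ _ (u 0) (Ordinal ik) (fun i : 'I_k => u i)).
Qed.

Variables (u : nat -> R) (C : R).
Hypothesis u_ge0 : forall i, 0 <= u i.
Hypothesis sum_u : forall n, \sum_(i < n) u i ^+ 2 <= C.

Lemma square_summable_cvg : cvgn (series (fun i => u i ^+ 2)).
Proof.
apply: nondecreasing_is_cvgn.
  by apply: nondecreasing_series => i _ _; exact: sqr_ge0.
by exists C => _ [n _ <-]; rewrite /series/= big_mkord.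
Qed.

Lemma square_summable_cvg0 : u k @[k --> \oo] --> 0.
Proof.
have /cvg_series_cvg_0 u2 := square_summable_cvg.
have : Num.sqrt (u k ^+ 2) @[k --> \oo] --> Num.sqrt (0 : R).
  exact: (continuous_cvg _ (@sqrt_continuous R 0)).
rewrite sqrtr0; under eq_fun do rewrite sqrtr_sqr ger0_norm//.
by [].
Qed.

(** If [N] is such that the tail of the squares from [N] on is below
    [e ^+ 2 / 2], then [(k - N) mu_k ^+ 2 <= e ^+ 2 / 2] for the running minimum
    [mu_k], and [k <= 2 (k - N)] as soon as [k >= 2 N]. *)
Lemma square_summable_min_littleo :
  ((fun k => \big[Num.min/u 0]_(i < k) u i) : nat -> R^o) =o_\oo
    (fun k : nat => (Num.sqrt k%:R)^-1 : R^o).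
Proof.
apply/eqoP => e e0.
set s := series (fun i => u i ^+ 2).
have sl : s n @[n --> \oo] --> limn s by exact: square_summable_cvg.
have e2 : 0 < e ^+ 2 / 2 by rewrite divr_gt0// exprn_gt0.
have [N _ sN] := (@cvgrPdist_lt _ _ _ _ _ _ _).1 sl _ e2.
apply: filterS (nbhs_infty_ge (2 * N).+1) => k /= Nk.
set mu := \big[_/_]_(i < k) _.
have mu0 : 0 <= mu by apply: le_bigmin => // j _.
have k0 : 0 < k%:R :> R by rewrite ltr0n (leq_trans _ Nk).
have NK : (N <= k)%N by rewrite (leq_trans _ (ltnW Nk))// leq_pmull.
have kmu : (k - N)%:R * mu ^+ 2 <= e ^+ 2 / 2.
  rewrite (le_trans (min_sqr_le_mean u_ge0 NK))// -sub_series_geq//.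
  have := sN N (leqnn _); rewrite ltr_norml => /andP[_ h].
  have sk : s k <= limn s.
    apply: nondecreasing_cvgn_le; last exact: square_summable_cvg.
    by apply: nondecreasing_series => i _ _; exact: sqr_ge0.
  by move: h sk; rewrite -/s; lra.
have NkR : 2 * N%:R <= k%:R :> R by rewrite -natrM ler_nat ltnW.
have kmu' : k%:R * mu ^+ 2 <= e ^+ 2.
  move: kmu; rewrite natrB// => kmu; have := sqr_ge0 mu; nra.
rewrite ger0_norm// ger0_norm ?invr_ge0// ler_pdivlMr ?sqrtr_gt0//.
rewrite -ler_sqr ?nnegrE ?mulr_ge0 ?(ltW e0)// exprMn sqr_sqrtr ?(ltW k0)//.
by rewrite mulrC.
Qed.

End real_sequences.

(** * The run of the algorithm *)

Section run.
Context {R : realType} {H : normedModType R} (ip : {dot H for idfun}).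
Hypothesis norm_ip : forall x : H, `|x| ^+ 2 = ip x x.
Variables (f : H -> R^o) (psi : H -> \bar R) (B : H -> {symmetric H}).
Hypothesis f_diff : forall x : H, differentiable f x.
Hypothesis B_bounded : forall x : H, bounded_form (B x).
Hypothesis psi_Nyoo : forall x : H, (-oo < psi x)%E.
Variable L : R.
Hypothesis L_ge0 : 0 <= L.
Hypothesis f_B : forall x y : H, dual_norm (residual f B x y) <= L * `|x - y|.
Variable solve : nat -> R -> H -> option H.
Hypothesis solveP : subproblem_solver ip f psi B L solve.
Variables (alpha beta m : R).
Hypotheses (alpha_gt0 : 0 < alpha) (alpha_le : alpha <= 1 / 2).
Hypotheses (beta_gt0 : 0 < beta) (beta_le : beta <= (m - 1) / (2 * m)).
Hypothesis m_ge1 : 1 <= m.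
Variables (x0 : H) (p0 : H -> R) (Lam0 : R).
Hypotheses (x0_dom : edom (objective f psi) x0) (Lam0_gt0 : 0 < Lam0).

Notation F := (objective f psi).
Notation trial := (accepted_trial ip f psi B solve alpha beta).
Notation is_run := (leap_ssn_run ip f psi B solve alpha beta x0 p0 Lam0).

Lemma trial_large_lambda (k : nat) (x : H) (lambda : R) :
  edom F x -> 0 < lambda -> m * L <= lambda -> exists xp, trial k x lambda xp.
Proof.
move=> Fx l0 mLl.
have Ll : L <= lambda by rewrite (le_trans _ mLl)// ler_peMl.
have [xp sxp] := solver_complete solveP k Ll Fx.
exists xp; split=> //.
apply: (admissible_accepted norm_ip f_diff B_bounded psi_Nyoo f_B
  L_ge0 m_ge1 mLl) => //.
exact: (solver_sound solveP (ltW l0) Fx sxp).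
Qed.

(** Doubling [lambda] eventually exceeds [m L], so the set of successful trial
    indices is nonempty and has a least element. *)
Lemma first_trial (k : nat) (x : H) (Lam : R) :
  edom F x -> 0 < Lam -> exists j xp, trial k x (2 ^+ j * Lam) xp /\
    forall i, (i < j)%N -> forall xp', ~ trial k x (2 ^+ i * Lam) xp'.
Proof.
move=> Fx Lam_gt0.
pose P j := `[< exists xp, trial k x (2 ^+ j * Lam) xp >].
have exP : exists j, P j.
  have mL0 : 0 <= m * L / Lam.
    by rewrite divr_ge0 ?mulr_ge0 ?(ltW Lam_gt0)// (le_trans ler01).
  exists (Num.bound (m * L / Lam)); apply/asboolP.
  apply: trial_large_lambda => //; first by rewrite mulr_gt0// exprn_gt0.
  rewrite -ler_pdivrMr// (le_trans (ltW (archi_boundP mL0)))//.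
  by rewrite -natrX ler_nat ltnW// ltn_expl.
case: (ex_minnP exP) => j /asboolP[xp jxp] jmin.
exists j, xp; split=> // i ij xp' ixp'.
suff : (j <= i)%N by rewrite leqNgt ij.
by apply: jmin; apply/asboolP; exists xp'.
Qed.

Lemma run_exists : exists r, is_run r.
Proof.
have : forall s : nat * (H * R), exists t : nat * H,
    edom F s.2.1 -> 0 < s.2.2 ->
    trial s.1 s.2.1 (2 ^+ t.1 * s.2.2) t.2 /\
    forall i, (i < t.1)%N -> forall xp, ~ trial s.1 s.2.1 (2 ^+ i * s.2.2) xp.
  move=> [k [x Lam]] /=.
  have [[Fx Lam_gt0]|N] := pselect (edom F x /\ 0 < Lam).
    by have [j [xp]] := first_trial k Fx Lam_gt0; exists (j, xp).
  by exists (0%N, x) => Fx Lam_gt0; case: N.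
(* [T (k, (x, Lam))] is the pair of the index and the result of the first
   successful trial of iteration [k] from [x]; it is iterated to produce the
   states [(x_k, Lambda_k)]. *)
move=> /choice[T TP].
pose fix s (k : nat) : H * R := if k is i.+1 then
  ((T (i, s i)).2, 2 ^+ (T (i, s i)).1 * (s i).2 / 2) else (x0, Lam0).
have sP k : edom F (s k).1 /\ 0 < (s k).2.
  elim: k => [//|k [Fs s0]] /=.
  have [[_ acc] _] := TP (k, s k) Fs s0.
  have l0 : 0 < 2 ^+ (T (k, s k)).1 * (s k).2 by rewrite mulr_gt0// exprn_gt0.
  split; last by rewrite divr_gt0.
  exact: (accepted_dom psi_Nyoo Fs acc).
pose lam k := 2 ^+ (T (k, s k)).1 * (s k).2.
exists (Iterates (fun k => (s k).1)
  (fun k => if k is i.+1 then F_prime ip f B (s i).1 (lam i) (s i.+1).1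
            else fun h => 'd f x0 h + p0 h)
  (fun k => (s k).2) lam (fun k => (T (k, s k)).1)).
split=> //= k; have [Fs s0] := sP k.
by have [acc first] := TP (k, s k) Fs s0; split.
Qed.

Lemma first_trial_unique (k : nat) (x : H) (Lam : R) (i j : nat) (xi xj : H) :
  trial k x (2 ^+ i * Lam) xi ->
  (forall l, (l < i)%N -> forall xp, ~ trial k x (2 ^+ l * Lam) xp) ->
  trial k x (2 ^+ j * Lam) xj ->
  (forall l, (l < j)%N -> forall xp, ~ trial k x (2 ^+ l * Lam) xp) ->
  i = j /\ xi = xj.
Proof.
move=> ti mi tj mj.
have ij : i = j.
  by case: (ltngtP i j) => // [/mj/(_ _ ti)|/mi/(_ _ tj)].
by split=> //; move: ti tj => [si _] [sj _]; move: si; rewrite ij sj => -[].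
Qed.

(** An attempt is a function of the iteration index, [lambda] and [x], so the
    first successful trial, and with it the next state, is determined. *)
Lemma run_unique (r r' : iterates) : is_run r -> is_run r' -> r = r'.
Proof.
move=> [x00 dF0 Lam00 rS] [x00' dF0' Lam00' rS'].
have stepE k : it_x r k = it_x r' k -> it_Lam r k = it_Lam r' k ->
    it_j r k = it_j r' k /\ it_x r k.+1 = it_x r' k.+1.
  move=> xE LamE; have [lE t mn _ _] := rS k; have [lE' t' mn' _ _] := rS' k.
  rewrite lE xE LamE in t mn; rewrite lE' in t'.
  exact: first_trial_unique t mn t' mn'.
have stateE k : it_x r k = it_x r' k /\ it_Lam r k = it_Lam r' k.
  elim: k => [|k [xE LamE]]; first by rewrite x00 Lam00.
  have [jE xE'] := stepE k xE LamE; split=> //.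
  have [lE _ _ -> _] := rS k; have [lE' _ _ -> _] := rS' k.
  by rewrite lE lE' jE LamE.
have xE k : it_x r k = it_x r' k by have [] := stateE k.
have LamE k : it_Lam r k = it_Lam r' k by have [] := stateE k.
have jE k : it_j r k = it_j r' k by have [] := stepE k (xE k) (LamE k).
have lamE k : it_lam r k = it_lam r' k.
  by have [-> _ _ _ _] := rS k; have [-> _ _ _ _] := rS' k; rewrite jE LamE.
have dFE k : it_dF r k = it_dF r' k.
  case: k => [|k]; first by rewrite dF0.
  by have [_ _ _ _ ->] := rS k; have [_ _ _ _ ->] := rS' k; rewrite !xE lamE.
case: r r' {x00 dF0 Lam00 rS x00' dF0' Lam00' rS' stepE stateE}
  xE LamE jE lamE dFE => x dF Lam lam j [x' dF' Lam' lam' j'] /=.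
by move=> /funext-> /funext-> /funext-> /funext-> /funext->.
Qed.

Variable r : @iterates R H.
Hypothesis rP : is_run r.

Lemma run_dom_Lam (k : nat) : edom F (it_x r k) /\ 0 < it_Lam r k.
Proof.
case: rP => x00 _ Lam00 rS; elim: k => [|k [Fx Lam_gt0]].
  by rewrite x00 Lam00.
have [lE [_ acc] _ -> _] := rS k; split.
  exact: (accepted_dom psi_Nyoo Fx acc).
by rewrite lE divr_gt0// mulr_gt0// exprn_gt0.
Qed.

Lemma run_dom (k : nat) : edom F (it_x r k).
Proof. by have [] := run_dom_Lam k. Qed.

Lemma run_lam_gt0 (k : nat) : 0 < it_lam r k.
Proof.
case: rP => _ _ _ /(_ k)[-> _ _ _ _].
by have [_ ?] := run_dom_Lam k; rewrite mulr_gt0// exprn_gt0.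
Qed.

(** If [j_k > 0] then [lambda_k / 2] has been rejected, hence is below [m L];
    otherwise [lambda_k] is [Lambda_k], which is [Lambda_0] or half of the
    previous regularisation parameter. *)
Lemma run_lam_le (k : nat) : it_lam r k <= Num.max (2 * m * L) Lam0.
Proof.
case: rP => _ _ Lam00 rS; have Lam_le n :
    it_Lam r n <= Num.max (2 * m * L) Lam0 ->
    it_lam r n <= Num.max (2 * m * L) Lam0.
  have [lE _ + _ _] := rS n; rewrite lE.
  case: (it_j r n) => [|j]; first by rewrite expr0 mul1r.
  move=> /(_ j (leqnn _)) nt _; rewrite le_max; apply/orP; left.
  have [Fx Lam_gt0] := run_dom_Lam n.
  have l0 : 0 < 2 ^+ j * it_Lam r n by rewrite mulr_gt0// exprn_gt0.
  have [mLl|] := leP (m * L) (2 ^+ j * it_Lam r n).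
    by have [xp txp] := trial_large_lambda n Fx l0 mLl; case: (nt xp).
  by rewrite exprS; lra.
suff h : it_Lam r k <= Num.max (2 * m * L) Lam0 by exact: Lam_le.
elim: k => [|k IH]; first by rewrite Lam00 le_max lexx orbT.
have [_ _ _ -> _] := rS k.
have := Lam_le k IH; have := run_lam_gt0 k; lra.
Qed.

Lemma run_gradient_decrease (k : nat) :
  beta * alpha ^+ 2 / it_lam r k * dual_norm (it_dF r k.+1) ^+ 2
    <= fine (F (it_x r k)) - fine (F (it_x r k.+1)).
Proof.
case: rP => _ _ _ /(_ k)[_ [_ acc] _ _ ->].
apply: accepted_gradient_decrease acc => //; first exact: run_lam_gt0.
exact: run_dom.
Qed.

Lemma run_decrease (k : nat) : fine (F (it_x r k)) <= fine (F x0).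
Proof.
case: rP => x00 _ _ rS; elim: k => [|k IH]; first by rewrite x00.
rewrite (le_trans _ IH)//; have [_ [_ acc] _ _ _] := rS k.
by apply: accepted_nonincreasing acc => //; [exact: run_lam_gt0|exact: run_dom].
Qed.

Lemma run_sublevel (k : nat) : sublevel F x0 (it_x r k).
Proof.
split; first exact: run_dom.
rewrite -(fineK (edom_fin psi_Nyoo (run_dom k))).
by rewrite -(fineK (edom_fin psi_Nyoo x0_dom)) lee_fin run_decrease.
Qed.

(** [run_gradient_decrease] telescopes once its varying factor [1 / lambda_k] is
    replaced by its lower bound from [run_lam_le]. *)
Lemma run_sum_gradients (Fstar : R) (n : nat) :
  (forall x, (Fstar%:E <= F x)%E) ->
  \sum_(i < n) dual_norm (it_dF r i.+1) ^+ 2 <=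
    Num.max (2 * m * L) Lam0 * (fine (F x0) - Fstar) / (beta * alpha ^+ 2).
Proof.
move=> Fmin; set M := Num.max _ _.
have M0 : 0 < M by rewrite lt_max Lam0_gt0 orbT.
have c0 : 0 < beta * alpha ^+ 2 by rewrite mulr_gt0// exprn_gt0.
rewrite ler_pdivlMr// mulr_suml.
apply: (@le_trans _ _ (\sum_(i < n)
    M * (fine (F (it_x r i)) - fine (F (it_x r i.+1))))).
  apply: ler_sum => i _; have l0 := run_lam_gt0 i.
  have := run_gradient_decrease i; rewrite mulrAC ler_pdivrMr// => h.
  rewrite mulrC (le_trans h)// mulrC ler_wpM2r ?run_lam_le//.
  by rewrite -(ler_pM2r l0) mul0r (le_trans _ h)// mulr_ge0 ?sqr_ge0// ltW.
rewrite -mulr_sumr ler_pM2l//.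
have -> : \sum_(i < n) (fine (F (it_x r i)) - fine (F (it_x r i.+1))) =
    fine (F (it_x r 0)) - fine (F (it_x r n)).
  elim: n => [|n IH]; first by rewrite big_ord0 subrr.
  by rewrite big_ord_recr/= IH; ring.
case: rP => -> _ _ _.
rewrite lerB// -lee_fin fineK//; exact: (edom_fin psi_Nyoo (run_dom n)).
Qed.

(** One iteration multiplies [Lambda_k] by [2^(j_k) / 2]. *)
Lemma run_Lam (n : nat) :
  2 ^+ (\sum_(i < n) it_j r i) * Lam0 = 2 ^+ n * it_Lam r n.
Proof.
case: rP => _ _ Lam00 rS; elim: n => [|n IH].
  by rewrite big_ord0 Lam00.
rewrite big_ord_recr/= exprD mulrAC IH.
have [lE _ _ -> _] := rS n; rewrite lE exprS; lra.
Qed.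

(** By [run_Lam] the number of rejected trials is
    [k + 1 + log2 (Lambda_{k+1} / Lambda_0)], and [Lambda_{k+1} = lambda_k / 2]
    is bounded by [run_lam_le]. *)
Lemma run_unaccepted (k : nat) :
  (unaccepted_newton_steps r k)%:R
    <= k.+1%:R + log2 (Num.max (1 / 2) (m * L / Lam0)).
Proof.
set N := unaccepted_newton_steps r k; set M := Num.max _ _.
have M0 : 0 < M by rewrite lt_max divr_gt0.
have NM : 2 ^+ N <= 2 ^+ k.+1 * M.
  rewrite -(ler_pM2r Lam0_gt0) run_Lam -mulrA ler_pM2l ?exprn_gt0//.
  case: rP => _ _ _ /(_ k)[_ _ _ -> _].
  rewrite /M maxr_pMl ?(ltW Lam0_gt0)// divfK ?gt_eqF//.
  have := run_lam_le k.
  by rewrite !le_max => /orP[] h; apply/orP; [right|left]; lra.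
have ln2 : 0 < ln 2 :> R by rewrite ln_gt0// ltr1n.
rewrite /log2 -(ler_pM2r ln2) mulrDl divfK ?gt_eqF//.
rewrite !mulr_natl -!lnXn// -lnM ?posrE ?exprn_gt0//.
by rewrite ler_ln ?posrE ?mulr_gt0 ?exprn_gt0.
Qed.

Lemma newton_stepsE (k : nat) :
  newton_steps r k = (k.+1 + unaccepted_newton_steps r k)%N.
Proof.
rewrite /newton_steps /unaccepted_newton_steps.
under eq_bigr do rewrite -add1n.
by rewrite big_split/= sum1_card card_ord.
Qed.

End run.

(** * Global convergence and complexity *)

Theorem theorem4p1 (R : realType) (H : completeNormedModType R)
  (ip : {dot H for idfun})
  (norm_ip : forall x : H, `|x| ^+ 2 = ip x x)
  (f : H -> R^o) (psi : H -> \bar R) (B : H -> {symmetric H})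
  (f_C11 : C11 f)
  (psi_proper : proper_function psi)
  (psi_convex : econvex_function psi)
  (psi_lsc : lower_semicontinuous psi)
  (B_bounded : forall x : H, bounded_form (B x))
  (Fstar : R)
  (Fstar_min : forall x : H, (Fstar%:E <= objective f psi x)%E)
  (S_nonempty : [set x : H | objective f psi x = Fstar%:E] !=set0)
  (L : R) (L_ge0 : 0 <= L)
  (f_B : forall x y : H,
    dual_norm (fun h => 'd f y h - 'd f x h - B x (y - x) h) <= L * `|x - y|)
  (solve : nat -> R -> H -> option H)
  (solveP : subproblem_solver ip f psi B L solve)
  (alpha beta m : R)
  (alpha_bnd : 0 < alpha <= 1 / 2)
  (m_ge1 : 1 <= m)
  (beta_bnd : 0 < beta <= (m - 1) / (2 * m))
  (x0 : H) (x0_dom : edom (objective f psi) x0)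
  (p0 : H -> R) (p0_sub : subdifferential psi x0 p0)
  (Lam0 : R) (Lam0_gt0 : 0 < Lam0) :
  (exists! r : iterates,
     leap_ssn_run ip f psi B solve alpha beta x0 p0 Lam0 r) /\
  forall r : iterates, leap_ssn_run ip f psi B solve alpha beta x0 p0 Lam0 r ->
  [/\ forall k : nat, sublevel (objective f psi) x0 (it_x r k),
      dual_norm (it_dF r k) @[k --> \oo] --> 0,
      forall k : nat, (1 <= k)%N ->
        min_dual_norm r k <=
          Num.sqrt (Num.max (2 * m * L) Lam0
                      * (fine (objective f psi x0) - Fstar))
            / Num.sqrt (beta * alpha ^+ 2 * k%:R),
      it_lam r k @[k --> \oo] --> 0 ->
        (min_dual_norm r : nat -> R^o) =o_\oo
          (fun k : nat => (Num.sqrt k%:R)^-1 : R^o) &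
      forall k : nat,
        (unaccepted_newton_steps r k)%:R
          <= k.+1%:R + log2 (Num.max (1 / 2) (m * L / Lam0)) /\
        (newton_steps r k)%:R
          <= 2 * k.+1%:R + log2 (Num.max (1 / 2) (m * L / Lam0))].
Proof.
have [[f_diff _] [psi_Nyoo _]] := (f_C11, psi_proper).
have [[alpha_gt0 alpha_le] [beta_gt0 beta_le]] :
    (0 < alpha /\ alpha <= 1 / 2) /\ (0 < beta /\ beta <= (m - 1) / (2 * m)).
  by move: alpha_bnd beta_bnd => /andP[-> ->] /andP[-> ->].
split.
  have [r rP] : exists r,
      leap_ssn_run ip f psi B solve alpha beta x0 p0 Lam0 r.
    exact: (run_exists norm_ip f_diff B_bounded psi_Nyoo L_ge0 f_B solveP
      alpha_le beta_le m_ge1 p0 x0_dom Lam0_gt0).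
  by exists r; split=> // r'; apply: run_unique.
move=> r rP; pose u i := dual_norm (it_dF r i.+1).
have u0 i : 0 <= u i by exact: dual_norm_ge0.
pose C := Num.max (2 * m * L) Lam0 * (fine (objective f psi x0) - Fstar)
  / (beta * alpha ^+ 2).
have uC n : \sum_(i < n) u i ^+ 2 <= C.
  exact: (run_sum_gradients norm_ip f_diff B_bounded psi_Nyoo L_ge0 f_B solveP
    alpha_gt0 alpha_le beta_gt0 beta_le m_ge1 x0_dom Lam0_gt0 rP n Fstar_min).
split.
- exact: (run_sublevel psi_Nyoo beta_gt0 x0_dom Lam0_gt0 rP).
- rewrite -(cvg_shiftS (fun k => dual_norm (it_dF r k))).
  exact: square_summable_cvg0 u0 uC.
- move=> k k1; have k0 : 0 < k%:R :> R by rewrite ltr0n.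
  have c0 : 0 < beta * alpha ^+ 2 by rewrite mulr_gt0// exprn_gt0.
  have mu0 : 0 <= min_dual_norm r k.
    by apply: le_bigmin => [|i _]; exact: dual_norm_ge0.
  have := le_trans (min_sqr_le_mean u0 (leq0n k)) _; rewrite big_mkord subn0.
  move=> /(_ _ (uC k)); rewrite -/(min_dual_norm r k) /C => h.
  rewrite ler_pdivlMr ?sqrtr_gt0 ?mulr_gt0//.
  rewrite -[min_dual_norm r k]ger0_norm// -sqrtr_sqr -sqrtrM ?sqr_ge0//.
  by rewrite ler_wsqrtr//; move: h; rewrite ler_pdivlMr//; lra.
- by move=> _; exact: square_summable_min_littleo u0 uC.
- have N_le k := run_unaccepted norm_ip f_diff B_bounded psi_Nyoo L_ge0 f_B
    solveP alpha_le beta_le m_ge1 x0_dom Lam0_gt0 rP k.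
  move=> k; split=> //; rewrite newton_stepsE natrD mulr_natl mulr2n -addrA.
  by rewrite lerD2l.
Qed.
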